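(* Let $N\in\mathbb{N}_*$ and $n\in\mathbb{N}_*$. If $$\min_{1\leqslant k\leqslant N}\ \min_{1\leqslant j\leqslant m_k}\mathbb{P}_n(A_j^{(k)})>0,$$ then $$\mathbb{P}_n^{(N)}=\arg\min\left\{ d_K(\mathbb{P}_n^{(N-1)}\,\|\,Q)\ :\ Q(A_j^{(N)})=P(A_j^{(N)})\ \text{for } 1\leqslant j\leqslant m_N,\ \ \mathrm{supp}(Q)=\{X_1,\dots,X_n\}\right\},$$ where $Q$ ranges over the probability measures supported by $\{X_1,\dots,X_n\}$.
   Context: $\mathbb{N}_*=\{1,2,\dots\}$. $X_1,\dots,X_n$ are independent random variables with law $P$ on a measurable space $(\mathcal{X},\mathcal{A})$. For each $N\in\mathbb{N}_*$, $\mathcal{A}^{(N)}=\{A_1^{(N)},\dots,A_{m_N}^{(N)}\}\subset\mathcal{A}$ is a finite partition of $\mathcal{X}$ with $m_N\geqslant 2$ and $\min_{1\leqslant j\leqslant m_N}P(A_j^{(N)})>0$; consecutive partitions are different. Empirical measure: $\mathbb{P}_n=\mathbb{P}_n^{(0)}=n^{-1}\sum_{i=1}^n\delta_{X_i}$. The $N$-th raking-ratio empirical measure is defined recursively, for $N\in\mathbb{N}_*$ and measurable real $f$, by $$\mathbb{P}_n^{(N)}(f)=\sum_{j=1}^{m_N}\frac{P(A_j^{(N)})}{\mathbb{P}_n^{(N-1)}(A_j^{(N)})}\,\mathbb{P}_n^{(N-1)}(f1_{A_j^{(N)}}),\qquad \mathbb{P}_n^{(N)}(A)=\mathbb{P}_n^{(N)}(1_A).$$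 It is a discrete probability measure on $\{X_1,\dots,X_n\}$. For probability measures $Q_n,Q$ supported by $\{X_1,\dots,X_n\}$ the relative entropy is $$d_K(Q_n\,\|\,Q)=\sum_{x\in\{X_1,\dots,X_n\}}Q_n(\{x\})\log\left(\frac{Q_n(\{x\})}{Q(\{x\})}\right),$$ the sum being over the distinct points of the sample. $\mathrm{supp}(Q)=\{X_1,\dots,X_n\}$ means that $Q$ is concentrated on this set and gives positive mass to each of its points. *)

(* Defs.v *)
From HB Require Import structures.
From mathcomp Require Import all_boot all_order all_algebra.
From mathcomp Require Import all_classical all_reals all_analysis.
Set Implicit Arguments.
Unset Strict Implicit.
Unset Printing Implicit Defensive.
Import Order.TTheory GRing.Theory Num.Theory.
Import numFieldNormedType.Exports.
Local Open Scope classical_set_scope.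
Local Open Scope ring_scope.

Definition mutually_independent d d' (Omega : measurableType d)
    (T : measurableType d') (R : realType) (Pr : probability Omega R) (n : nat)
    (X : 'I_n -> {RV Pr >-> T}) : Prop :=
  forall (J : {set 'I_n}) (B : 'I_n -> set T), (forall i, measurable (B i)) ->
  Pr (\bigcap_(i in [set` J]) (X i @^-1` B i)) =
  (\prod_(i in J) Pr (X i @^-1` B i))%E.

(* The power set sigma-algebra: singletons need not be measurable in [T], and
   the masses [Q [set y]] of a measure carried by the sample must make sense. *)
Definition discrete_space d (T : measurableType d) :=
  g_sigma_algebraType [set: set T].

(* The functional [f |-> P_n^(N)(f)] for the realized sample
   [x 0, ..., x (n - 1)]; the partitions used are [A 1, A 2, ...], and the
   value of the sequences [m] and [A] at 0 is never used. *)
Fixpoint raking d (T : measurableType d) (R : realType)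
    (P : set T -> \bar R) (m : nat -> nat) (A : forall k, 'I_(m k) -> set T)
    (n : nat) (x : 'I_n -> T) (N : nat) (f : T -> R) : R :=
  if N is N'.+1 then
    \sum_(j < m N'.+1)
      fine (P (A N'.+1 j)) / raking P A x N' \1_(A N'.+1 j)
      * raking P A x N' (fun y => f y * \1_(A N'.+1 j) y)
  else n%:R^-1 * \sum_(i < n) f (x i).

Definition raking_measure d (T : measurableType d) (R : realType)
    (P : set T -> \bar R) (m : nat -> nat) (A : forall k, 'I_(m k) -> set T)
    (n : nat) (x : 'I_n -> T) (N : nat) (B : set T) : \bar R :=
  (raking P A x N \1_B)%:E.

Definition has_support d (T : measurableType d) (R : realType)
    (Q : probability (discrete_space T) R) (S : set T) : Prop :=
  Q (~` S) = 0%E /\ forall y, S y -> (0 < Q [set y])%E.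

(* [range x] is the set of distinct sample points. Meaningful when [Q] charges
   every point charged by [Qn]; since [ln 0 = 0], points with [Qn [set y] = 0]
   contribute 0. *)
Definition relative_entropy d (T : measurableType d) (R : realType) (n : nat)
    (x : 'I_n -> T) (Qn Q : set T -> \bar R) : R :=
  \sum_(y \in range x)
    fine (Qn [set y]) * ln (fine (Qn [set y]) / fine (Q [set y])).

Definition argmin (U : Type) (R : realType) (D : set U) (F : U -> R) : set U :=
  [set u | D u /\ forall v, D v -> F u <= F v].

(* Main.v *)
(** Write [p], [r] for the point masses of [P_n^(N-1)], [P_n^(N)] and [q] for
    those of a competitor [Q].  On a cell [A_j] the ratio [p / r] is the
    constant [p(A_j) / P(A_j)], so the constraint [q(A_j) = P(A_j)] gives
    [\sum p q / r = \sum_j p(A_j) = \sum p].  Hence the entropy difference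
    [\sum p ln (r / q)] equals [\sum p (q / r - 1 - ln (q / r))], which is
    nonnegative and vanishes only when [q = r]. *)
Require Import Defs.
From HB Require Import structures.
From mathcomp Require Import all_boot all_order all_algebra.
From mathcomp Require Import all_classical all_reals all_analysis.
From mathcomp Require Import ring.
Set Implicit Arguments.
Unset Strict Implicit.
Unset Printing Implicit Defensive.
Import Order.TTheory GRing.Theory Num.Theory.
Import numFieldNormedType.Exports.
Local Open Scope classical_set_scope.
Local Open Scope ring_scope.

(** * A strict logarithmic inequality and the entropy comparison *)

Lemma ln_lt_sub1 (R : realType) (t : R) : 0 < t -> t != 1 -> ln t < t - 1.
Proof.
(* Exponentiating turns the claim into [1 + u < expR u] at the nonzero point [u = t - 1]. *)
move=> t0 t1; rewrite -ltr_expR lnK ?posrE//.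
by rewrite -{1}(subrKC 1 t) expR_gt1Dx// subr_eq0.
Qed.

(** The bound on the ratio sum stands in for normalisation: the entropy difference is the sum of the
    [gap] terms minus a nonpositive quantity. *)
Lemma sum_ln_ratio_ge (R : realType) (I : eqType) (s : seq I) (p r q : I -> R) :
  {in s, forall y, 0 < p y} -> {in s, forall y, 0 < r y} ->
  {in s, forall y, 0 < q y} ->
  \sum_(y <- s) p y * (q y / r y) <= \sum_(y <- s) p y ->
  \sum_(y <- s) p y * ln (p y / r y) <= \sum_(y <- s) p y * ln (p y / q y) /\
  (\sum_(y <- s) p y * ln (p y / q y) <= \sum_(y <- s) p y * ln (p y / r y) ->
   {in s, q =1 r}).
Proof.
move=> p0 r0 q0 le_pqr.
pose gap y := p y * (q y / r y - 1 - ln (q y / r y)).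
have gap_ge0 y : y \in s -> 0 <= gap y.
  move=> ys; apply: mulr_ge0; first by rewrite ltW// p0.
  rewrite subr_ge0.
  have [->|qr1] := eqVneq (q y / r y) 1; first by rewrite ln1 subrr.
  by rewrite ltW// ln_lt_sub1// divr_gt0 ?q0 ?r0.
have gap_sum : \sum_(y <- s) gap y =
    \sum_(y <- s) p y * (q y / r y) - \sum_(y <- s) p y +
    (\sum_(y <- s) p y * ln (p y / q y) - \sum_(y <- s) p y * ln (p y / r y)).
  rewrite -!sumrB -big_split /= !big_seq; apply: eq_bigr => y ys.
  rewrite !ln_div ?posrE ?p0 ?q0 ?r0// /gap.
  by rewrite ln_div ?posrE ?q0 ?r0//; ring.
have sum_ge0 : 0 <= \sum_(y <- s) gap y.
  by rewrite big_seq sumr_ge0// => y; apply: gap_ge0.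
split.
  rewrite -subr_ge0; apply: le_trans sum_ge0 _.
  by rewrite gap_sum gerDr subr_le0.
move=> le_qr y ys; apply/eqP/negPn/negP => qr.
(* One point with [q y != r y] makes the total strictly positive, whereas [gap_sum] and the two
   assumed inequalities bound it by 0. *)
have : 0 < \sum_(y <- s) gap y.
  rewrite (big_rem _ ys)/= ltr_wpDr//.
    rewrite big_seq sumr_ge0// => z /mem_rem; exact: gap_ge0.
  rewrite mulr_gt0 ?p0// subr_gt0 ln_lt_sub1 ?divr_gt0 ?q0 ?r0//.
  apply: contra qr => /eqP qr1.
  by rewrite -(divfK (lt0r_neq0 (r0 _ ys)) (q y)) qr1 mul1r.
by rewrite gap_sum ltNge -[leRHS]addr0 lerD// subr_le0.
Qed.

(** * Finite partitions and finitely supported probabilities *)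

Lemma sum_indic_partition (R : realType) (T : Type) (m : nat)
    (A : 'I_m -> set T) (g : 'I_m -> R) (j : 'I_m) (y : T) :
  partition [set: 'I_m] A [set: T] -> A j y ->
  \sum_(k < m) g k * \1_(A k) y = g j.
Proof.
move=> [_ tA _] Ajy; rewrite (bigD1 j)//= indicE mem_set// mulr1 big1 ?addr0//.
move=> k kj; rewrite indicE memNset ?mulr0// => Aky.
by move/eqP: kj; apply; apply: tA => //; exists y.
Qed.

Lemma partition_cell (T : Type) (m : nat) (A : 'I_m -> set T) (y : T) :
  partition [set: 'I_m] A [set: T] -> exists j, A j y.
Proof. by case=> + _ _ => /seteqP[_ /(_ y I)] [j _ Ajy]; exists j. Qed.

Lemma probability_partition (d : measure_display) (T : measurableType d)
    (R : realType) (P : probability T R) (m : nat) (A : 'I_m -> set T) :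
  (forall j, measurable (A j)) -> partition [set: 'I_m] A [set: T] ->
  \sum_(j < m) fine (P (A j)) = 1.
Proof.
move=> mA [cA tA _]; apply: EFin_inj; rewrite -sumEFin.
rewrite -(probability_setT P) -cA /cover.
rewrite measure_fin_bigcup//; last exact: finite_finset.
rewrite (@fsbig_fwiden _ _ _ _ (index_enum 'I_m))//=; last 3 first.
- by move=> j _; apply: mem_index_enum.
- exact: index_enum_uniq.
- by move=> j [_ []].
by apply: eq_bigr => j _; rewrite fineK// fin_num_measure.
Qed.

Lemma range_ord_undup (T : choiceType) (n : nat) (x : 'I_n -> T) :
  range x = [set` undup (codom x)].
Proof.
apply/seteqP; split=> y /=; rewrite mem_undup.
  by case=> i _ <-; exact: codom_f.
by case/codomP => i ->; exists i.
Qed.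

Lemma discrete_measurable (d : measure_display) (T : measurableType d)
    (B : set (discrete_space T)) : measurable B.
Proof. exact: sub_gen_smallest. Qed.

(** The mass outside [s] is null, so [B] may be cut down to [s]; additivity then peels off one atom
    at a time. *)
Lemma discrete_probability_sum (d : measure_display) (T : measurableType d)
    (R : realType) (Q : probability (discrete_space T) R) (s : seq T)
    (B : set T) :
  uniq s -> Q (~` [set` s]) = 0%E ->
  Q B = (\sum_(y <- s) fine (Q [set y]) * \1_B y)%:E.
Proof.
move=> us Qs0.
have mT (C : set T) : measurable (C : set (discrete_space T)).
  exact: discrete_measurable.
have finQ (C : set T) : Q C \is a fin_num by rewrite fin_num_measure.
have QBs : Q (B `\` [set` s]) = 0%E.
  by apply: (subset_measure0 _ _ _ Qs0) => // y [].
have -> : Q B = Q (B `&` [set` s]).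
  by rewrite -[in LHS](setUIDK B [set` s]) measureU0//; exact: discrete_measurable.
elim: s us {Qs0 QBs} => [_|z s IH /= /andP[zs us]].
  by rewrite big_nil set_nil setI0 measure0.
have -> : [set` z :: s] = [set z] `|` [set` s].
  apply/seteqP; split=> y /=; rewrite in_cons.
    by move=> /orP[/eqP|]; [left|right].
  by case=> ->; rewrite ?eqxx ?orbT.
rewrite setIUr measureU//; last first.
  by apply/seteqP; split=> y // [[_ /= ->] [_ /=]]; rewrite (negbTE zs).
rewrite big_cons EFinD; congr (_ + _)%E; last exact: IH.
rewrite indicE; have [Bz|Bz] := pselect (B z).
  by rewrite mem_set// mulr1 fineK// setIC; congr (Q _); apply/setIidPl => y ->.
rewrite memNset// mulr0.
rewrite (_ : B `&` _ = set0) ?measure0//.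
by apply/seteqP; split=> y // [By /= yz]; apply: Bz; rewrite -yz.
Qed.

(** Once the set functions agree, the packed axioms are proofs of the same propositions, identified
    by proof irrelevance. *)
Lemma probability_eq (d : measure_display) (T : measurableType d)
    (R : realType) (P Q : probability T R) : (forall B, P B = Q B) -> P = Q.
Proof.
case: P Q => [p [[a b] [c] [e] [f] [g] [h] [k]]].
case=> [q [[a' b'] [c'] [e'] [f'] [g'] [h'] [k']]].
move=> /= /funext pq; subst q.
have <- := Prop_irrelevance a a'; have <- := Prop_irrelevance b b'.
have <- := Prop_irrelevance c c'; have <- := Prop_irrelevance e e'.
have <- := Prop_irrelevance f f'; have <- := Prop_irrelevance g g'.
by have <- := Prop_irrelevance h h'; have <- := Prop_irrelevance k k'.
Qed.

Lemma point_mass_probability (d : measure_display) (T : measurableType d)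
    (R : realType) (n : nat) (x : 'I_n -> T) (w : 'I_n -> R) :
  (forall i, 0 <= w i) -> \sum_(i < n) w i = 1 ->
  exists Q : probability (discrete_space T) R,
    forall B, Q B = (\sum_(i < n) w i * \1_B (x i))%:E.
Proof.
move=> w0 w1.
(* [msum] takes a sequence over [nat]; indices from [n] on get the zero measure and stay outside the
   sum. Repeated values of [x] just add their weights. *)
pose mu (k : nat) : {measure set (discrete_space T) -> \bar R} :=
  if insub k is Some i
  then mscale (NngNum (w0 i)) (dirac (x i : discrete_space T))
  else mzero.
have muE B : msum mu n B = (\sum_(i < n) w i * \1_B (x i))%:E.
  rewrite /msum -sumEFin; apply: eq_bigr => i _.
  by rewrite /mu valK.
have muT : msum mu n [set: discrete_space T] = 1%E.
  rewrite muE; congr EFin; rewrite -w1.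
  by apply: eq_bigr => i _; rewrite indicT mulr1.
pose Q : probability (discrete_space T) R :=
  HB.pack (msum mu n) (Measure_isProbability.Build _ _ _ (msum mu n) muT).
by exists Q.
Qed.

(** * Raking as a reweighting of the sample *)

(** The weight belongs to the index [i], not to the point [x i], so tied observations are kept
    apart. For a partition, the sum selects the update factor of the one cell containing [x i]. *)
Fixpoint raking_weight (d : measure_display) (T : measurableType d)
    (R : realType) (P : set T -> \bar R) (m : nat -> nat)
    (A : forall k, 'I_(m k) -> set T) (n : nat) (x : 'I_n -> T) (N : nat)
    (i : 'I_n) : R :=
  if N is N'.+1 then
    raking_weight P A x N' i *
    \sum_(j < m N'.+1) fine (P (A N'.+1 j)) / raking P A x N' \1_(A N'.+1 j)
                       * \1_(A N'.+1 j) (x i)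
  else n%:R^-1.

Section Raking.
Context (d : measure_display) (T : measurableType d) (R : realType).
Context (P : probability T R) (m : nat -> nat) (A : forall k, 'I_(m k) -> set T).
Context (n : nat) (x : 'I_n -> T).
Arguments A : clear implicits.

Local Notation rk := (raking P A x).
Local Notation w := (raking_weight P A x).

(** The recursion only multiplies [f] by cell indicators, so [f (x i)] factors out at every
    stage. *)
Lemma rakingE N f : rk N f = \sum_(i < n) w N i * f (x i).
Proof.
elim: N f => [|N IH] f; first by rewrite /= mulr_sumr.
rewrite /=; under eq_bigr do rewrite [X in _ * X]IH mulr_sumr.
rewrite exchange_big /=; apply: eq_bigr => i _.
by rewrite mulr_sumr mulr_suml; apply: eq_bigr => j _; rewrite !mulrA; ring.
Qed.

Lemma eq_raking N f g : (forall i, f (x i) = g (x i)) -> rk N f = rk N g.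
Proof. by move=> fg; rewrite !rakingE; apply: eq_bigr => i _; rewrite fg. Qed.

(** Tied indices are grouped here: this passes from sums over indices to the sums over distinct
    points that the entropy uses. *)
Lemma raking_sum_point N f :
  rk N f = \sum_(y <- undup (codom x)) rk N \1_[set y] * f y.
Proof.
under eq_bigr do rewrite rakingE mulr_suml.
rewrite exchange_big rakingE /=; apply: eq_bigr => i _.
rewrite (bigD1_seq (x i)) ?undup_uniq ?mem_undup ?codom_f//=.
rewrite indicE mem_set// mulr1 big1 ?addr0// => y yx.
rewrite indicE memNset ?mulr0 ?mul0r// => /= xy.
by rewrite xy eqxx in yx.
Qed.

Lemma raking_point N j y : partition [set: 'I_(m N.+1)] (A N.+1) [set: T] ->
  A N.+1 j y ->
  rk N.+1 \1_[set y] =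
  fine (P (A N.+1 j)) / rk N \1_(A N.+1 j) * rk N \1_[set y].
Proof.
move=> pA Ajy.
rewrite -(sum_indic_partition
  (fun j => fine (P (A N.+1 j)) / rk N \1_(A N.+1 j)) pA Ajy) mulr_suml /=.
apply: eq_bigr => k _; rewrite -[RHS]mulrA; congr (_ * _).
rewrite !rakingE mulr_sumr; apply: eq_bigr => i _.
rewrite [RHS]mulrCA; congr (_ * _); rewrite mulrC.
(* Away from [y] both sides vanish; at [y] they are the same product. *)
have [->//|xy] := eqVneq (x i) y.
by rewrite (indicE _ [set y]) memNset ?mulr0//; apply/eqP.
Qed.

(** Disjointness kills every term but the [j]-th, whose denominator cancels against the old mass of
    the cell. *)
Lemma raking_cell N j : partition [set: 'I_(m N.+1)] (A N.+1) [set: T] ->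
  rk N \1_(A N.+1 j) != 0 -> rk N.+1 \1_(A N.+1 j) = fine (P (A N.+1 j)).
Proof.
move=> [_ tA _] rj; rewrite /= (bigD1 j)//= big1 ?addr0.
  rewrite (@eq_raking _ _ (\1_(A N.+1 j))) ?divfK// => i.
  by rewrite indicE -natrM mulnb andbb.
move=> k kj; rewrite [X in _ * X](_ : _ = 0) ?mulr0//.
rewrite rakingE big1// => i _; rewrite !indicE -natrM mulnb.
case: andP; rewrite ?mulr0// => -[/set_mem Aji /set_mem Aki].
by move/eqP: kj; case; apply: tA => //; exists (x i).
Qed.

Lemma raking_cell_gt0 N (B : set T) : (forall i, 0 < w N i) ->
  (exists i, B (x i)) -> 0 < rk N \1_B.
Proof.
move=> w0 [i Bi]; rewrite rakingE (bigD1 i)//= indicE mem_set// mulr1.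
by rewrite ltr_pwDl// sumr_ge0// => k _; rewrite mulr_ge0// ltW.
Qed.

(** While all weights are positive, a cell containing a sample point has positive mass, so the next
    update factor is a quotient of positive numbers. *)
Lemma raking_weight_gt0 N : (0 < n)%N ->
  (forall k, (0 < k)%N -> partition [set: 'I_(m k)] (A k) [set: T]) ->
  (forall k, (0 < k)%N -> forall j, 0 < fine (P (A k j))) ->
  (forall k, (0 < k <= N)%N -> forall j, exists i, A k j (x i)) ->
  forall i, 0 < w N i.
Proof.
move=> n0 pA PA; elim: N => [|N IH] xA i /=; first by rewrite invr_gt0 ltr0n.
have wN : forall i, 0 < w N i.
  by apply: IH => k /andP[k0 kN]; apply: xA; rewrite k0 ltnW.
have [j Aj] := partition_cell (x i) (pA N.+1 isT).
rewrite mulr_gt0// (sum_indic_partition _ (pA N.+1 isT) Aj).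
by rewrite divr_gt0 ?PA// raking_cell_gt0//; apply: xA; rewrite ltnS leqnn.
Qed.

(** Each index lies in exactly one cell, so the total weight is the sum of the cell masses, which
    raking has just prescribed. *)
Lemma raking_weight_sum N :
  partition [set: 'I_(m N.+1)] (A N.+1) [set: T] ->
  (forall j, rk N \1_(A N.+1 j) != 0) ->
  \sum_(i < n) w N.+1 i = \sum_(j < m N.+1) fine (P (A N.+1 j)).
Proof.
move=> pA rA; under [RHS]eq_bigr do rewrite -raking_cell// rakingE.
rewrite exchange_big /=; apply: eq_bigr => i _.
have [j Aj] := partition_cell (x i) pA.
exact/esym/(sum_indic_partition (fun=> w N.+1 i) pA Aj).
Qed.

Lemma raking_sum_ratio N (q : T -> R) :
  partition [set: 'I_(m N.+1)] (A N.+1) [set: T] ->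
  (forall j, 0 < fine (P (A N.+1 j))) ->
  (forall i, 0 < w N i) ->
  (forall j, exists i, A N.+1 j (x i)) ->
  (forall j, \sum_(y <- undup (codom x)) q y * \1_(A N.+1 j) y =
             fine (P (A N.+1 j))) ->
  \sum_(y <- undup (codom x)) rk N \1_[set y] * (q y / rk N.+1 \1_[set y]) =
  \sum_(y <- undup (codom x)) rk N \1_[set y].
Proof.
move=> pA P0 w0 xA qA.
have cell0 j : 0 < rk N \1_(A N.+1 j) by exact: raking_cell_gt0.
(* Both sides equal the total stage-[N] mass of the cells. On the left, the constraint on [q]
   cancels the constant ratio of each cell; on the right, cells are split into atoms. *)
transitivity (\sum_(j < m N.+1) rk N \1_(A N.+1 j)).
  transitivity (\sum_(j < m N.+1) rk N \1_(A N.+1 j) / fine (P (A N.+1 j)) *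
                 \sum_(y <- undup (codom x)) q y * \1_(A N.+1 j) y).
    under [RHS]eq_bigr do rewrite mulr_sumr.
    rewrite [RHS]exchange_big [LHS]big_seq [RHS]big_seq; apply: eq_bigr => y.
    rewrite mem_undup => /codomP[i ->].
    have [j Aj] := partition_cell (x i) pA.
    under [RHS]eq_bigr do rewrite mulrA.
    rewrite (sum_indic_partition _ pA Aj) (raking_point pA Aj).
    have p0 : 0 < rk N \1_[set x i] by apply: raking_cell_gt0 => //; exists i.
    by field; rewrite !gt_eqF.
  by apply: eq_bigr => j _; rewrite qA divfK// gt_eqF.
under eq_bigr do rewrite raking_sum_point.
rewrite exchange_big /=; apply: eq_bigr => y _.
have [j Aj] := partition_cell y pA.
by rewrite (sum_indic_partition (fun=> _) pA Aj).
Qed.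

End Raking.

(** * Minimality and uniqueness of the raked measure *)

Theorem proposition1 (R : realType) (d d' : measure_display)
    (Omega : measurableType d) (T : measurableType d')
    (Pr : probability Omega R) (P : probability T R)
    (m : nat -> nat) (A : forall k, 'I_(m k) -> set T)
    (hm : forall k, (0 < k)%N -> (2 <= m k)%N)
    (hAmeas : forall k, (0 < k)%N -> forall j, measurable (A k j))
    (hApart : forall k, (0 < k)%N -> partition [set: 'I_(m k)] (A k) [set: T])
    (hApos : forall k, (0 < k)%N -> forall j, (0 < P (A k j))%E)
    (hAdiff : forall k, (0 < k)%N -> range (A k) <> range (A k.+1))
    (n : nat) (hn : (0 < n)%N)
    (X : 'I_n -> {RV Pr >-> T})
    (hXindep : mutually_independent X)
    (hXlaw : forall i (B : set T), measurable B ->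
       distribution Pr (X i) B = P B)
    (N : nat) (hN : (0 < N)%N) (omega : Omega)
    (x := fun i : 'I_n => X i omega)
    (hmin : forall k, (1 <= k <= N)%N -> forall j,
       (0 < raking_measure P A x 0 (A k j))%E) :
  exists PN : probability (discrete_space T) R,
    (forall B : set T, PN B = raking_measure P A x N B) /\
    argmin
      [set Q : probability (discrete_space T) R |
         (forall j, Q (A N j) = P (A N j)) /\ has_support Q (range x)]
      (fun Q => relative_entropy x (raking_measure P A x N.-1) Q)
    = [set PN].
Proof.
(* From here [N] is the previous stage and [N.+1] the stage of the statement. *)
case: N hN hmin => // N _ hmin.
have fineP k j : (0 < k)%N -> (fine (P (A k j)))%:E = P (A k j).
  by move=> k0; rewrite fineK// fin_num_measure//; exact: hAmeas.
have P0 k : (0 < k)%N -> forall j, 0 < fine (P (A k j)).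
  by move=> k0 j; rewrite -lte_fin fineP// hApos.
(* Positive empirical mass of a cell means that some observation falls in it. *)
have xA k : (0 < k <= N.+1)%N -> forall j, exists i, A k j (x i).
  move=> kN j; have := hmin k kN j; rewrite lte_fin /= => r0.
  apply: contrapT => nA; move: r0; rewrite big1 ?mulr0 ?ltxx// => i _.
  by rewrite indicE memNset// => Ai; apply: nA; exists i.
have w0 : forall i, 0 < raking_weight P A x N i.
  apply: raking_weight_gt0 => // k /andP[k0 kN].
  by apply: xA; rewrite k0 ltnW.
have w1 : forall i, 0 < raking_weight P A x N.+1 i by exact: raking_weight_gt0.
have xAN : forall j, exists i, A N.+1 j (x i) by apply: xA; rewrite ltnS leqnn.
have cell_neq0 j : raking P A x N \1_(A N.+1 j) != 0.
  by rewrite gt_eqF// raking_cell_gt0.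
have pA := hApart N.+1 isT.
have w_sum : \sum_(i < n) raking_weight P A x N.+1 i = 1.
  by rewrite raking_weight_sum// probability_partition//; exact: hAmeas.
have [PN PN_sum] := point_mass_probability x (fun i => ltW (w1 i)) w_sum.
have PNE B : PN B = raking_measure P A x N.+1 B.
  by rewrite PN_sum /raking_measure rakingE.
exists PN; split=> //.
have point0 k : (forall i, 0 < raking_weight P A x k i) ->
    {in undup (codom x), forall y, 0 < raking P A x k \1_[set y]}.
  move=> wk y; rewrite mem_undup => /codomP[i ->].
  by apply: raking_cell_gt0 => //; exists i.
have entropyE (Q : probability (discrete_space T) R) :
    relative_entropy x (raking_measure P A x N) Q =
    \sum_(y <- undup (codom x)) raking P A x N \1_[set y] *
      ln (raking P A x N \1_[set y] / fine (Q [set y])).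
  by rewrite /relative_entropy range_ord_undup -fsbig_seq ?undup_uniq.
have PN_constr : (forall j, PN (A N.+1 j) = P (A N.+1 j)) /\
    has_support PN (range x).
  split=> [j|]; first by rewrite PNE /raking_measure raking_cell// fineP.
  split=> [|y]; rewrite PNE /raking_measure.
    rewrite rakingE big1// => i _; rewrite indicE memNset ?mulr0//.
    by apply; exists i.
  by rewrite lte_fin => -[i _ <-]; apply: point0; rewrite ?mem_undup ?codom_f.
(* The first half gives minimality of [PN], the second that no other admissible measure attains the
   minimum. *)
have min_PN (Q : probability (discrete_space T) R) :
    (forall j, Q (A N.+1 j) = P (A N.+1 j)) /\ has_support Q (range x) ->
    relative_entropy x (raking_measure P A x N) PN <=
      relative_entropy x (raking_measure P A x N) Q /\
    (relative_entropy x (raking_measure P A x N) Q <=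
       relative_entropy x (raking_measure P A x N) PN -> Q = PN).
  move=> [QA [Qsupp Q0]]; rewrite range_ord_undup in Qsupp Q0.
  have q0 : {in undup (codom x), forall y, 0 < fine (Q [set y])}.
    move=> y ys; rewrite -lte_fin fineK; first exact: Q0.
    by rewrite fin_num_measure//; exact: discrete_measurable.
  have Qsum B := discrete_probability_sum B (undup_uniq _) Qsupp.
  have qA j : \sum_(y <- undup (codom x)) fine (Q [set y]) * \1_(A N.+1 j) y =
      fine (P (A N.+1 j)).
    by apply: EFin_inj; rewrite -Qsum QA fineP.
  have := raking_sum_ratio pA (P0 N.+1 isT) w0 xAN qA.
  move=> /eqP; rewrite eq_le => /andP[le_ratio _].
  have [le_PN eq_PN] :=
    sum_ln_ratio_ge (point0 N w0) (point0 N.+1 w1) q0 le_ratio.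
  have entropyPN : relative_entropy x (raking_measure P A x N) PN =
      \sum_(y <- undup (codom x)) raking P A x N \1_[set y] *
        ln (raking P A x N \1_[set y] / raking P A x N.+1 \1_[set y]).
    by rewrite entropyE; apply: eq_bigr => y _; rewrite PNE.
  rewrite entropyPN entropyE; split=> // /eq_PN qr.
  (* Equal atoms suffice, since both measures are carried by the sample points. *)
  apply: probability_eq => B.
  rewrite Qsum PNE /raking_measure raking_sum_point; congr EFin.
  by rewrite big_seq [RHS]big_seq; apply: eq_bigr => y ys; rewrite qr.
(* A minimiser [Q] is compared with the admissible [PN], which forces equality. *)
apply/seteqP; split=> [Q [DQ minQ]|_ ->].
  by have [_ eqQ] := min_PN Q DQ; apply: eqQ; exact: minQ.
by split=> // Q /min_PN[].
Qed.
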